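(* Let $(\overline{Q}_1,\dots,\overline{Q}_M)$ be a fluid-model solution of the lowerbound system or of the upperbound system. If $\overline{Q}_i(0)=q(0)$ for all $i=1,\dots,M$, then $\overline{Q}_i(t)=q(t)$ for all $i=1,\dots,M$ and all $t\ge 0$, where $q$ satisfies $$q(t)=q(0)\bigl(1-G(\overline{\eta}(0,t))\bigr)+\frac{\lambda}{M}\int_{0}^{t}\bigl(1-F_{X_{\min}}(\overline{\eta}(s,t))\bigr)\,ds,$$ with $$\overline{\eta}(s,t)=\frac{1}{\binom{N-1}{d-1}}\int_s^t\varphi(q(u))\,du,\qquad \varphi(x)=\frac1x \text{ for } x>0,\quad \varphi(0)=0,$$ i.e. $q$ is the fluid limit of an $M/X_{\min}/1/PS$ queue with arrival rate $\lambda/M$ and server speed $1/\binom{N-1}{d-1}$.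
   Context: Let $1\le d\le N$ be integers, $\lambda>0$, $M=\binom{N}{d}$, and let $\boldsymbol{s}^1,\dots,\boldsymbol{s}^M$ enumerate the $d$-element subsets of $\{1,\dots,N\}$ (servers). $X_{\min}=\min\{X_1,\dots,X_d\}$ is the minimum of the $d$ (possibly dependent) replica sizes of a job, with distribution function $F_{X_{\min}}$, and $G$ is the service time distribution of initial jobs. PS denotes processor sharing. For $\boldsymbol{Q}=(Q_1,\dots,Q_M)$ with non-negative entries, the service rate per job at virtual queue $i$ is, whenever $Q_i>0$, $$\varphi_i(\boldsymbol{Q})=\frac{1}{\min_{j\in \boldsymbol{s}^i}\sum_{k:\,j\in \boldsymbol{s}^k}Q_k}\ \text{ (lowerbound system)},\qquad \varphi_i(\boldsymbol{Q})=\frac{1}{\max_{j\in \boldsymbol{s}^i}\sum_{k:\,j\in \boldsymbol{s}^k}Q_k}\ \text{ (upperbound system)},$$ and $\varphi_i(\boldsymbol{Q})=0$ if $Q_i=0$. A fluid-model solution of the respective system is a vector of non-negative continuous functions $\overline{Q}_1,\dots,\overline{Q}_M$ satisfying, for all $i$ and $t\ge0$, $$\overline{Q}_i(t)=\overline{Q}_i(0)\bigl(1-G(\overline{\eta}_i(0,t))\bigr)+\frac{\lambda}{M}\int_0^t\bigl(1-F_{X_{\min}}(\overline{\eta}_i(s,t))\bigr)\,ds,\qquad \overline{\eta}_i(s,t)=\int_s^t\varphi_i(\overline{\boldsymbol{Q}}(u))\,du .$$ *)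

(* Defs.v *)
From HB Require Import structures.
From mathcomp Require Import all_boot all_order all_algebra.
From mathcomp Require Import all_classical all_reals all_analysis.
From mathcomp Require Import measurable_realfun.

Set Implicit Arguments.
Unset Strict Implicit.
Unset Printing Implicit Defensive.

Import Order.TTheory GRing.Theory Num.Theory.
Import numFieldNormedType.Exports.

Local Open Scope classical_set_scope.
Local Open Scope ring_scope.

(* Minimum and maximum of f over a nonempty finite set A. The seed of the
   iteration is the value of f at some element of A, so that it does not affect
   the result; see minoverP and maxoverP. Both are 0 when A is empty. *)
Definition minover (R : realType) (I : finType) (A : {set I}) (f : I -> R) : R :=
  if [pick i in A] is Some i0 then \big[Order.min/f i0]_(i in A) f i else 0.

Definition maxover (R : realType) (I : finType) (A : {set I}) (f : I -> R) : R :=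
  if [pick i in A] is Some i0 then \big[Order.max/f i0]_(i in A) f i else 0.

Lemma minoverP (R : realType) (I : finType) (A : {set I}) (f : I -> R) :
  A != finset.set0 ->
  (exists2 i, i \in A & minover A f = f i) /\
  (forall i, i \in A -> minover A f <= f i).
Proof.
move=> /set0Pn A0; rewrite /minover.
case: pickP => [i0 Ai0|/= A_]; last by case: A0 => i; rewrite A_.
split; last by move=> i Ai; exact: bigmin_le_cond.
apply: (big_ind (fun x => exists2 i, i \in A & x = f i)) => [|x y|i Ai].
- by exists i0.
- by move=> [i Ai ->] [j Aj ->]; case: leP => _; [exists i|exists j].
- by exists i.
Qed.

Lemma maxoverP (R : realType) (I : finType) (A : {set I}) (f : I -> R) :
  A != finset.set0 ->
  (exists2 i, i \in A & maxover A f = f i) /\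
  (forall i, i \in A -> f i <= maxover A f).
Proof.
move=> /set0Pn A0; rewrite /maxover.
case: pickP => [i0 Ai0|/= A_]; last by case: A0 => i; rewrite A_.
split; last by move=> i Ai; exact: le_bigmax_cond.
apply: (big_ind (fun x => exists2 i, i \in A & x = f i)) => [|x y|i Ai].
- by exists i0.
- by move=> [i Ai ->] [j Aj ->]; case: leP => _; [exists j|exists i].
- by exists i.
Qed.

Definition Xmin (disp : measure_display) (T : measurableType disp)
    (R : realType) (P : probability T R) (d : nat)
    (X : 'I_d -> {RV P >-> R}) : T -> R :=
  fun w => minover [set: 'I_d]%SET (fun i => X i w).

Lemma measurable_Xmin (disp : measure_display) (T : measurableType disp)
    (R : realType) (P : probability T R) (d : nat)
    (X : 'I_d -> {RV P >-> R}) : measurable_fun [set: T] (Xmin X).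
Proof.
rewrite /Xmin /minover; case: pickP => [i0 _|_]; last exact: measurable_cst.
elim: (index_enum _) => [|j r IHr].
  by rewrite (_ : (fun=> _) = X i0)//; apply/funext => w; rewrite big_nil.
rewrite (_ : (fun=> _) = fun w =>
    Order.min (X j w) (\big[Order.min/X i0 w]_(i <- r | i \in [set: 'I_d]%SET) X i w)).
  exact: measurable_minr.
by apply/funext => w; rewrite big_cons inE.
Qed.

HB.instance Definition _ (disp : measure_display) (T : measurableType disp)
    (R : realType) (P : probability T R) (d : nat) (X : 'I_d -> {RV P >-> R}) :=
  isMeasurableFun.Build _ _ T R (Xmin X) (measurable_Xmin X).

(* The cumulated service eta below is an integral of an unbounded function and
   may be infinite (for instance when a queue starts empty), hence distribution
   functions are extended to \bar R by their limits at the infinities. *)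
Definition ecdf (disp : measure_display) (T : measurableType disp)
    (R : realType) (P : probability T R) (X : {RV P >-> R}) (x : \bar R) :
    \bar R :=
  match x with
  | r%:E => cdf X r
  | +oo => 1
  | -oo => 0
  end%E.

Definition ecdf_Xmin (disp : measure_display) (T : measurableType disp)
    (R : realType) (P : probability T R) (d : nat)
    (X : 'I_d -> {RV P >-> R}) : \bar R -> \bar R :=
  ecdf (Xmin X : {RV P >-> R}).

(* s enumerates the d-element subsets of the N servers. *)
Definition enum_subsets (N d : nat) (s : 'I_('C(N, d)) -> {set 'I_N}) : Prop :=
  injective s /\ forall A : {set 'I_N}, (exists i, s i = A) <-> #|A| = d.

Definition server_load (R : realType) (N M : nat) (s : 'I_M -> {set 'I_N})
    (x : 'I_M -> R) (j : 'I_N) : R :=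
  \sum_(k < M | j \in s k) x k.

Definition phi_lower (R : realType) (N M : nat) (s : 'I_M -> {set 'I_N})
    (x : 'I_M -> R) (i : 'I_M) : R :=
  if 0 < x i then (minover (s i) (server_load s x))^-1 else 0.

Definition phi_upper (R : realType) (N M : nat) (s : 'I_M -> {set 'I_N})
    (x : 'I_M -> R) (i : 'I_M) : R :=
  if 0 < x i then (maxover (s i) (server_load s x))^-1 else 0.

(* cumulated service of a rate r over [s, t] *)
Definition service (R : realType) (r : R -> R) (s t : R) : \bar R :=
  (\int[lebesgue_measure]_(u in `[s, t]) (r u)%:E)%E.

(* q(t) = q(0) (1 - G(eta(0,t))) + a \int_0^t (1 - F(eta(s,t))) ds, t >= 0 *)
Definition fluid_equation (R : realType) (a : R) (F G : \bar R -> \bar R)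
    (eta : R -> R -> \bar R) (q : R -> R) : Prop :=
  forall t : R, 0 <= t ->
    ((q t)%:E = (q 0)%:E * (1 - G (eta 0%R t))
      + a%:E * \int[lebesgue_measure]_(s in `[0%R, t]) (1 - F (eta s t)))%E.

Definition nonneg_continuous (R : realType) (q : R -> R) : Prop :=
  {within `[0, +oo[, continuous q} /\ forall t : R, 0 <= t -> 0 <= q t.

(* Fluid-model solution with M virtual queues, total arrival rate lambda and
   per-job service rates phi. *)
Definition fluid_solution (R : realType) (M : nat) (lambda : R)
    (F G : \bar R -> \bar R) (phi : ('I_M -> R) -> 'I_M -> R)
    (Q : 'I_M -> R -> R) : Prop :=
  forall i : 'I_M,
    nonneg_continuous (Q i) /\
    fluid_equation (lambda / M%:R) F G
      (service (fun u => phi (fun k => Q k u) i)) (Q i).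

Definition phi_single (R : realType) (x : R) : R := if 0 < x then x^-1 else 0.

(* Fluid limit of a single processor-sharing queue with arrival rate a and
   server speed c. *)
Definition PS_fluid_solution (R : realType) (a c : R)
    (F G : \bar R -> \bar R) (q : R -> R) : Prop :=
  nonneg_continuous q /\
  fluid_equation a F G
    (fun s t => c%:E * service (fun u => phi_single (q u)) s t)%E q.

(* Main.v *)
Require Import Defs.
From mathcomp Require Import all_boot all_order all_algebra.
From mathcomp Require Import all_classical all_reals all_analysis.
From mathcomp Require Import measurable_realfun ring lra.

Import Order.TTheory GRing.Theory Num.Theory.
Import numFieldNormedType.Exports HBNNSimple.

(** Why the theorem holds.

    Let c = 1 / C(N-1, d-1).  Every server belongs to C(N-1, d-1) of the
    subsets, so if all queues lie between lo and hi, then all server loads lie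
    between lo / c and hi / c, and every nonempty queue is served, per job, at a
    rate between c / hi and c / lo ([balanced_phi_lower],
    [balanced_phi_upper]).  A single processor-sharing queue of speed c obeys
    the same two bounds.  Hence it suffices to show that the members of any
    finite family of such coupled queues with a common initial value coincide
    ([coupled_queues_equal]): applied to the Q_i this says that each Q_i is a
    single-queue fluid limit, and applied to the Q_i together with a given
    single-queue fluid limit q it says that q is the common value.

    As long as all queues are positive, let u and l be their maximum and
    minimum, with clocks A' = c / u and B' = c / l.  Then A <= B.  If
    B(z) = A(t), then z <= t, the jobs present at time 0 have been served at
    least as much in any queue at t as in any other queue at z, and so has every
    cohort of arrivals s <= z; only the arrivals in ]z, t] can make the
    difference, whence u(t) - l(z) <= a (t - z).  For the time lag
    t - B^-1(A(t)) this is a linear differential inequality with initial value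
    0, so the lag vanishes, and the same estimate with z = t gives u = l
    ([clock_comparison], [equal_while_positive]).

    When the start is empty the lag estimate degenerates, and scaling takes over.
    With J(k) = E[1 - exp(-k X)], a queue empty at time o and then served at rate
    c / (m (u - o)) at each time u holds a (t - o) J(m / c) at time t.  Let m be the best constant with
    Q_i(t) <= m t for all i and t; then m <= a J(m / c)
    ([zero_start_growth]).  Unless the sizes X vanish almost surely, J is strictly
    concave with J(0) = 0, so m' < a J(m' / c) for every m' < m, and a
    first-touching argument shows that queues which are all positive at z stay
    above m' (t - z) ([linear_lower]).  All queues are positive at arbitrarily
    small times z, so m t <= Q_i(t) as well ([equal_from_empty]).  If X vanishes
    almost surely, arrivals leave at once and empty queues stay empty
    ([extinction]).

    Finally, queues started at q0 > 0 which become empty at a first time z would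
    do so simultaneously and then restart from zero; the restart forces
    m <= a J(m / c) for some m > 0, and then [linear_lower] from time 0
    contradicts emptiness at z ([equal_from_positive]). *)

Set Implicit Arguments.
Unset Strict Implicit.
Unset Printing Implicit Defensive.

Local Open Scope classical_set_scope.
Local Open Scope ring_scope.

(** * Integrals and primitives *)

(** Integrals of nonnegative functions are suprema over the simple functions
    below them, so this holds for arbitrary integrands. *)
Lemma le_integral_subset d (T : measurableType d) (R : realType)
    (mu : {measure set T -> \bar R}) (D E : set T) (f g : T -> \bar R) :
  D `<=` E -> (forall x, D x -> 0 <= f x)%E -> (forall x, E x -> 0 <= g x)%E ->
  (forall x, D x -> f x <= g x)%E ->
  (\int[mu]_(x in D) f x <= \int[mu]_(x in E) g x)%E.
Proof.
move=> DE f0 g0 fg; rewrite !ge0_integralE//.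
apply: ereal_sup_le => _ [h hf <-].
exists h => //= x.
apply: (le_trans (hf x)); rewrite !patchE.
case: ifPn => [/set_mem Dx|_].
  by rewrite mem_set; [exact: fg|exact: DE].
by case: ifPn => [/set_mem|//]; exact: g0.
Qed.

Lemma cst_le_integral (R : realType) (k : \bar R) (z t : R)
    (D : set R) (f : R -> \bar R) :
  (0 <= k)%E -> z < t -> `]z, t] `<=` D -> (forall u, D u -> 0 <= f u)%E ->
  (forall u, (z < u <= t)%R -> (k <= f u)%E) ->
  (k * (t - z)%:E <= \int[lebesgue_measure]_(u in D) f u)%E.
Proof.
move=> k0 zt ztD f0 kf.
have -> : (k * (t - z)%:E = \int[lebesgue_measure]_(u in `]z, t]) k)%E.
  by rewrite integral_cst//= lebesgue_measure_itv/= lte_fin zt EFinB.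
apply: le_integral_subset => [//|u _|u|u]; [exact: k0|exact: f0|].
by rewrite /= in_itv/=; exact: kf.
Qed.

Lemma integral_primitive (R : realType) (A f : R -> R) (s t : R) :
  s <= t -> (forall x, s <= x <= t -> is_derive x 1 A (f x)) ->
  (forall x, s <= x <= t -> {for x, continuous f}) ->
  (\int[lebesgue_measure]_(x in `[s, t]) (f x)%:E = (A t - A s)%:E)%E.
Proof.
rewrite le_eqVlt => /predU1P[<- _ _|st dA cf].
  by rewrite set_itv1 integral_set1 subrr.
have cA x : s <= x <= t -> {for x, continuous A}.
  move=> /dA[dx _]; exact/differentiable_continuous/derivable1_diffP.
rewrite (@continuous_FTC2 _ f A)//.
- apply: continuous_in_subspaceT => x; rewrite inE/= in_itv/=; exact: cf.
- split.
  + move=> x; rewrite in_itv/= => /andP[/ltW sx /ltW xt].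
    by apply: ex_derive; apply: dA; rewrite sx.
  + by apply: cvg_at_right_filter; apply: cA; rewrite lexx ltW.
  + by apply: cvg_at_left_filter; apply: cA; rewrite lexx ltW.
- move=> x; rewrite in_itv/= => /andP[/ltW sx /ltW xt].
  by rewrite derive1E; apply: derive_val; apply: dA; rewrite sx.
Qed.

Lemma is_derive1_chain (R : realType) (f g : R -> R) (x df dg : R) :
  is_derive x 1 g dg -> is_derive (g x) 1 f df ->
  is_derive x 1 (fun y => f (g y)) (df * dg).
Proof.
move=> [xg <-] [xf <-]; split.
  by apply/derivable1_diffP/differentiable_comp; exact/derivable1_diffP.
by rewrite -!derive1E derive1_comp.
Qed.

(** The clock of a queue of size proportional to [u - o] is logarithmic. *)
Lemma integral_log_rate (R : realType) (b o s t : R) : o < s -> s <= t ->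
  (\int[lebesgue_measure]_(u in `[s, t]) (b / (u - o))%:E
   = (b * (ln (t - o) - ln (s - o)))%:E)%E.
Proof.
move=> os st.
have d0 x : s <= x <= t -> 0 < x - o.
  by move=> /andP[sx _]; rewrite subr_gt0 (lt_le_trans os).
rewrite mulrBr; apply: (@integral_primitive _ (fun u => b * ln (u - o))) => //.
- move=> x /d0 x0; rewrite -[b / _]/(b *: (x - o)^-1).
  apply: is_deriveZ; rewrite -[(x - o)^-1]mulr1.
  apply: (@is_derive1_chain _ (@ln R) (fun u => u - o)).
    by rewrite -[X in is_derive _ _ _ X]subr0; apply: is_deriveB.
  exact: is_derive1_ln.
- move=> x /d0 x0.
  apply: cvgM; first exact: cvg_cst.
  apply: cvgV; first by rewrite gt_eqF.
  by apply: cvgB => //; exact: cvg_cst.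
Qed.

(** The base point -1 leaves room for evaluating the primitive slightly to the
    left of 0, as is done in [clock_comparison]. *)
Lemma increasing_primitive (R : realType) (f : R -> R) :
  continuous f -> (forall x, 0 < f x) ->
  exists A : R -> R, [/\ A 0 = 0,
    forall t : R, -1 < t -> is_derive t 1 A (f t) &
    forall s t : R, -1 < s -> s < t -> A s < A t].
Proof.
move=> cf f0; pose F (t : R) := (\int[lebesgue_measure]_(x in `[(-1)%R, t]) f x)%R.
pose A (t : R) := F t - F 0.
have dA (t : R) : -1 < t -> is_derive t 1 A (f t).
  move=> t1.
  have intf : lebesgue_measure.-integrable `[-1, t + 1] (EFin \o f).
    apply: continuous_compact_integrable; first exact: segment_compact.
    exact: continuous_subspaceT.
  have [|dF F'] := @continuous_FTC1_closed R f (-1) t (t + 1) _ intf t1 (cf t).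
    by rewrite ltrDl.
  rewrite -[f t]subr0; apply: is_deriveB.
  by split=> //; rewrite -derive1E.
exists A; split=> //; first by rewrite /A subrr.
move=> s t s1 st.
have dAs x : x \in `]s, t[ -> is_derive x 1 A (f x).
  by rewrite in_itv/= => /andP[sx _]; apply: dA; exact: lt_trans sx.
have [|x _ Ax] := MVT st dAs.
  apply: derivable_within_continuous => x; rewrite in_itv/= => /andP[sx _].
  by apply: ex_derive; apply: dA; exact: lt_le_trans sx.
by rewrite -subr_gt0 Ax mulr_gt0// subr_gt0.
Qed.

Lemma service_log_le (R : realType) (r : R -> R) (b o s t : R) :
  0 <= b -> o < s -> s <= t -> (forall u, s <= u <= t -> b / (u - o) <= r u) ->
  ((b * (ln (t - o) - ln (s - o)))%:E <= service r s t)%E.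
Proof.
move=> b0 os st br; rewrite -integral_log_rate//.
have rate0 u : s <= u <= t -> 0 <= b / (u - o).
  by move=> /andP[su _]; rewrite divr_ge0// subr_ge0 (le_trans (ltW os)).
apply: le_integral_subset => [//|u|u|u];
  rewrite /= in_itv/= => sut; rewrite lee_fin.
- exact: rate0.
- by rewrite (le_trans (rate0 _ sut)) ?br.
- exact: br.
Qed.

Lemma service_le_log (R : realType) (r : R -> R) (b o s t : R) :
  o < s -> s <= t -> (forall u, s <= u <= t -> 0 <= r u <= b / (u - o)) ->
  (service r s t <= (b * (ln (t - o) - ln (s - o)))%:E)%E.
Proof.
move=> os st rb; rewrite -integral_log_rate//.
apply: le_integral_subset => [//|u|u|u];
  rewrite /= in_itv/= => /rb/andP[r0 rb'];
  by rewrite lee_fin// (le_trans r0).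
Qed.

(** * Survival function and Laplace transform of a job size *)

Lemma lt_log_rateE (R : realType) (o s t b x : R) : o < s -> o < t -> 0 < b ->
  (b * (ln (t - o) - ln (s - o)) < x)
  = (o + (t - o) * expR (- (b^-1 * x)) < s).
Proof.
move=> os ot b0; have so0 : 0 < s - o by rewrite subr_gt0.
have to0 : 0 < t - o by rewrite subr_gt0.
rewrite -[RHS]ltrBrDl -[RHS]ltr_ln ?posrE ?mulr_gt0 ?expR_gt0//.
rewrite lnM ?posrE ?expR_gt0// expRK -[LHS]ltr_pdivlMl//.
by rewrite ltrBlDr ltrBlDl addrC.
Qed.

(** Strict concavity of [k |-> 1 - exp (- k x)], from the tangent to [exp] at
    [- k' x]. *)
Lemma expR_chord_lt (R : realType) (k k' x : R) : 0 < k' -> k' < k -> 0 < x ->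
  k' * (1 - expR (- (k * x))) < k * (1 - expR (- (k' * x))).
Proof.
move=> k'0 k'k x0.
have tangent h : h != 0 -> expR (- (k' * x)) * (1 + h) < expR (- (k' * x) + h).
  by move=> h0; rewrite expRD ltr_pM2l ?expR_gt0// expR_gt1Dx.
have t1 : expR (- (k' * x)) * (1 + k' * x) < 1.
  by have := tangent (k' * x); rewrite addNr expR0; apply; rewrite gt_eqF// mulr_gt0.
have t2 : expR (- (k' * x)) * (1 - (k - k') * x) < expR (- (k * x)).
  have := tangent (- ((k - k') * x)).
  rewrite (_ : - (k' * x) - (k - k') * x = - (k * x)); last by ring.
  by apply; rewrite oppr_eq0 gt_eqF// mulr_gt0// subr_gt0.
nra.
Qed.

Lemma expR_chord (R : realType) (k k' x : R) : 0 < k' -> k' < k -> 0 <= x ->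
  k' * (1 - expR (- (k * x))) <= k * (1 - expR (- (k' * x))).
Proof.
move=> k'0 k'k; rewrite le_eqVlt => /predU1P[<-|x0]; last exact/ltW/expR_chord_lt.
by rewrite !mulr0 oppr0 expR0 subrr !mulr0.
Qed.

Section Survival.
Context d (T : measurableType d) (R : realType) (P : probability T R).
Variable X : {RV P >-> R}.

Definition survival (x : \bar R) : \bar R := (1 - ecdf X x)%E.

Lemma survivalE (r : R) : survival r%:E = P [set w | r < X w].
Proof.
rewrite /survival /= -ccdf_1_cdf /ccdf /distribution /pushforward.
by congr (P _); apply/seteqP; split => w /=; rewrite in_itv/= andbT.
Qed.

Lemma survival_pinfty : survival +oo%E = 0%E.
Proof. by rewrite /survival /= subee. Qed.

Lemma survival_ge0 x : (0 <= survival x)%E.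
Proof.
rewrite /survival; case: x => [r| |] /=.
- by rewrite sube_ge0 ?cdf_le1// fin_num_measure.
- by rewrite subee.
- by rewrite sube0.
Qed.

Lemma survival_le1 x : (survival x <= 1)%E.
Proof.
rewrite /survival; case: x => [r| |] /=.
- by rewrite leeBlDr ?fin_num_measure// leeDl// cdf_ge0.
- by rewrite subee// lee_fin.
- by rewrite sube0.
Qed.

Lemma survival_antitone x y : (x <= y)%E -> (survival y <= survival x)%E.
Proof.
move: x y => [x| |] [y| |] //= xy; rewrite ?survival_pinfty ?survival_ge0//.
- by rewrite /survival; apply: leeB => //; exact: cdf_nondecreasing.
- by rewrite {2}/survival /= sube0 survival_le1.
Qed.

Lemma survival_fin_num x : survival x \is a fin_num.
Proof.
by rewrite ge0_fin_numE ?survival_ge0// (le_lt_trans (survival_le1 x)) ?ltry.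
Qed.

Hypothesis X_ge0 : forall w, 0 <= X w.

Definition laplace_defect (k : R) : R := fine 'E_P[fun w => 1 - expR (- (k * X w))].

Let mdefect (k : R) : measurable_fun setT (fun w => 1 - expR (- (k * X w))).
Proof.
apply: measurable_funB => //; apply: measurableT_comp => //.
by apply: measurable_funN; exact: measurable_funM.
Qed.

Let defect01 (k : R) w : 0 <= k -> 0 <= 1 - expR (- (k * X w)) <= 1.
Proof.
move=> k0; rewrite subr_ge0 lerBlDr lerDl expR_ge0 andbT.
by rewrite -expR0 ler_expR oppr_le0 mulr_ge0.
Qed.

Lemma laplace_defectE (k : R) : 0 <= k ->
  ('E_P[fun w => (1 - expR (- (k * X w)))%R] = (laplace_defect k)%:E)%E.
Proof.
move=> k0; rewrite /laplace_defect fineK// ge0_fin_numE; last first.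
  by apply: expectation_ge0 => w; case/andP: (defect01 w k0).
apply: (@le_lt_trans _ _ (expectation P (cst 1%R : T -> R))); last first.
  by rewrite expectation_cst ltry.
apply: expectation_le => //.
- by move=> w; case/andP: (defect01 w k0).
- by apply/aeW => w; case/andP: (defect01 w k0).
Qed.

Lemma laplace_defect_ge0 (k : R) : 0 <= k -> 0 <= laplace_defect k.
Proof.
move=> k0; rewrite -lee_fin -laplace_defectE//.
by apply: expectation_ge0 => w; case/andP: (defect01 w k0).
Qed.

(** Tonelli: [s] contributes exactly when [W < s], where
    [W = o + (t - o) exp (- X / b)], so the integral is the expectation of
    [t - W]. *)
Lemma integral_survival_log (o t b : R) : o < t -> 0 < b ->
  (\int[lebesgue_measure]_(s in `]o, t])
      survival (b * (ln (t - o) - ln (s - o)))%:E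
   = ((t - o) * laplace_defect b^-1)%:E)%E.
Proof.
move=> ot b0.
pose W w := o + (t - o) * expR (- (b^-1 * X w)).
have to0 : 0 < t - o by rewrite subr_gt0.
have Wt w : W w <= t.
  rewrite /W -lerBrDl ler_piMr ?(ltW to0)// -[leRHS]expR0 ler_expR oppr_le0.
  by rewrite mulr_ge0// invr_ge0 ltW.
have oW w : o < W w by rewrite ltrDl mulr_gt0// expR_gt0.
have mW : measurable_fun setT W.
  apply: measurable_funD => //; apply: measurable_funM => //.
  apply: measurableT_comp => //; apply: measurable_funN; exact: measurable_funM.
transitivity (\int[lebesgue_measure]_s \int[P]_w (\1_(`]W w, t]) s)%:E)%E.
  rewrite integral_mkcond; apply: eq_integral => s _; rewrite patchE.
  case: ifPn => [/set_mem|/negP sot].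
    rewrite /= in_itv/= => /andP[os st].
    have so0 : 0 < s - o by rewrite subr_gt0.
    rewrite survivalE.
    rewrite (_ : [set w | _] = [set w | W w < s]); last first.
      by apply/funext => w /=; rewrite lt_log_rateE.
    rewrite -[LHS]expectation_indic; last first.
      by rewrite -[X in measurable X]setTI; exact: measurable_fun_ltr.
    rewrite unlock; apply: eq_integral => w _.
    rewrite !indicE; have [Ws|sW] := ltP (W w) s.
      by rewrite !mem_set//= in_itv/= Ws.
    rewrite !memNset//=; last by apply/negP; rewrite -leNgt.
    by rewrite in_itv/= ltNge sW.
  symmetry; apply: integral0_eq => w _.
  rewrite indicE memNset//= in_itv/= => /andP[Ws st].
  by apply: sot; rewrite inE/= in_itv/= st (lt_trans (oW w)).
transitivity (\int[P]_w \int[lebesgue_measure]_s (\1_(`]W w, t]) s)%:E)%E.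
  apply: (fubini_tonelli (m1 := lebesgue_measure) (m2 := P)
      (fun p : measurableTypeR R * T => (\1_(`]W p.2, t]) p.1)%:E)) => [|p].
    2: by rewrite lee_fin indicE.
  apply/measurable_EFinP/measurable_indic => /=.
  rewrite [X in measurable X](_ : _ =
      [set p : measurableTypeR R * T | (fun p => W p.2) p < p.1]
      `&` [set p | p.1 <= t]).
    apply: measurableI.
      rewrite -[X in measurable X]setTI; apply: measurable_fun_ltr => //=.
      exact: measurableT_comp.
    rewrite -[X in measurable X]setTI; exact: measurable_fun_ler.
  by apply/seteqP; split => p /=; rewrite in_itv/= => /andP.
transitivity ((t - o)%:E * 'E_P[fun w => (1 - expR (- (b^-1 * X w)))%R])%E; last first.
  by rewrite laplace_defectE ?invr_ge0 1?ltW// EFinM.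
rewrite unlock -ge0_integralZl_EFin//; last 3 first.
- by move=> w _; rewrite lee_fin; case/andP: (defect01 w (ltW (eqbRL (invr_gt0 b) b0))).
- exact/measurable_EFinP.
- exact: ltW.
apply: eq_integral => w _.
rewrite integral_indic//= setIT lebesgue_measure_itv/= lte_fin.
rewrite -EFinM -EFinD.
have -> : (t - o) * (1 - expR (- (b^-1 * X w))) = t - W w by rewrite /W; ring.
by case: ltP => // tW; congr EFin; rewrite (@le_anti _ _ t (W w)) ?subrr// tW Wt.
Qed.

(** Strictness of the pointwise inequality survives integration because [X] is
    positive with positive probability. *)
Lemma laplace_defect_concave (k k' : R) : 0 < k' -> k' < k -> (0 < survival 0)%E ->
  k' * laplace_defect k < k * laplace_defect k'.
Proof.
move=> k'0 k'k S0; have k0 := lt_trans k'0 k'k.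
pose g w := k * (1 - expR (- (k' * X w))) - k' * (1 - expR (- (k * X w))).
have g0 w : 0 <= g w by rewrite subr_ge0 expR_chord.
have mg : measurable_fun setT g.
  by apply: measurable_funB; apply: measurable_funM => //; exact: mdefect.
have int_scale c j : 0 <= c -> 0 <= j ->
    (\int[P]_w (c * (1 - expR (- (j * X w))))%:E = (c * laplace_defect j)%:E)%E.
  move=> c0 j0; rewrite EFinM -laplace_defectE// unlock.
  rewrite -ge0_integralZl_EFin//.
    by move=> w _; rewrite lee_fin; case/andP: (defect01 w j0).
  exact/measurable_EFinP.
have : (\int[P]_w (g w)%:E + (k' * laplace_defect k)%:E
        = (k * laplace_defect k')%:E)%E.
  rewrite -!int_scale ?ltW// -ge0_integralD//.
  - by apply: eq_integral => w _; rewrite -EFinD subrK.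
  - by move=> w _; rewrite lee_fin g0.
  - exact/measurable_EFinP.
  - move=> w _; rewrite lee_fin mulr_ge0 ?(ltW k'0)//.
    by case/andP: (defect01 w (ltW k0)).
  - by apply/measurable_EFinP/measurable_funM => //; exact: mdefect.
rewrite -lte_fin => <-; rewrite -[X in (X < _)%E]add0e lteD2rE//.
rewrite lt0e integral_ge0 ?andbT; last by move=> w _; rewrite lee_fin.
apply/eqP => Ig0.
have /ae_eq_integral_abs : (\int[P]_w `|(g w)%:E| = 0)%E.
  by rewrite -Ig0; apply: eq_integral => w _; rewrite gee0_abs// lee_fin.
move=> /(_ measurableT) [|N [mN PN0 gN]]; first exact/measurable_EFinP.
move: S0; rewrite survivalE lt_neqAle => /andP[/eqP]; case.
apply/esym/eqP; rewrite -measure_le0 -PN0; apply: le_measure; rewrite ?inE//.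
  by rewrite -[X in measurable X]setTI; exact: measurable_fun_ltr.
move=> w /= Xw0; apply: gN => /= /(_ Logic.I) [] /eqP; apply/negP.
by rewrite gt_eqF// subr_gt0 expR_chord_lt.
Qed.

End Survival.

(** * Induction on the real line and comparison of clocks *)

(** At the infimum of the counterexamples, the third hypothesis
    fails if it is a counterexample, and the second one if it is not. *)
Lemma real_induction (R : realType) (p : R -> Prop) (t0 t1 : R) :
  p t0 ->
  (forall t, t0 <= t <= t1 -> p t -> \forall u \near t, p u) ->
  (forall t, t0 < t <= t1 -> (forall s, t0 <= s < t -> p s) -> p t) ->
  forall t, t0 <= t <= t1 -> p t.
Proof.
move=> p0 p_open p_step t /andP[t0t tt1]; apply: contrapT => npt.
pose S := [set u | t0 <= u <= t1 /\ ~ p u].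
have St : S t by split=> //; rewrite t0t.
have lbS : has_lbound S by exists t0 => u [/andP[]].
have infS : has_inf S by split=> //; exists t.
have t0i : t0 <= inf S by apply: lb_le_inf => [|u [/andP[]]]; first by exists t.
have it1 : inf S <= t1 by rewrite (le_trans _ tt1)// ge_inf.
have pbelow s : t0 <= s < inf S -> p s.
  move=> /andP[t0s si]; apply: contrapT => nps.
  have : S s by split=> //; rewrite t0s (le_trans (ltW si)).
  by move=> /(ge_inf lbS); rewrite leNgt si.
have pi : p (inf S).
  move: (t0i); rewrite le_eqVlt => /predU1P[<-//|t0i'].
  by apply: p_step => //; rewrite t0i'.
have /nbhs_ballP[e /= e0 ball_p] : \forall u \near inf S, p u.
  by apply: p_open => //; rewrite t0i.
have [u Su] := inf_adherent e0 infS.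
have iu := ge_inf lbS Su.
move=> uie; case: Su => _; apply; apply: ball_p.
by rewrite /ball /= ler0_norm ?subr_le0// opprB ltrBlDl.
Qed.

Lemma ge0_left_limit (R : realType) (f : R -> R) (t0 t : R) : t0 < t ->
  {for t, continuous f} -> (forall s, t0 <= s < t -> 0 <= f s) -> 0 <= f t.
Proof.
move=> t0t cf f0; rewrite leNgt; apply/negP => ft0.
have fneg : \forall s \near t^'-, f s < 0.
  by apply: cvgr_lt ft0; exact: cvg_at_left_filter.
have [s [/= fs0 t0s st]] : exists s, [/\ f s < 0, t0 < s & s < t].
  apply: (@filter_ex _ (t^'-)); near=> s; split; near: s => //.
  - exact: nbhs_left_gt.
  - exact: nbhs_left_lt.
by move: fs0; rewrite ltNge f0// st ltW.
Unshelve. all: by end_near. Qed.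

Lemma last_zero (R : realType) (f : R -> R) (t0 t : R) :
  continuous f -> t0 <= t -> f t0 = 0 -> f t != 0 ->
  exists z, [/\ t0 <= z, z < t, f z = 0 & forall u, z < u <= t -> f u != 0].
Proof.
move=> cf t0t ft0 ftn0.
pose S := [set u | t0 <= u <= t /\ f u = 0].
have S0 : S t0 by rewrite /S/= lexx t0t.
have ubS : has_ubound S by exists t => u [/andP[]].
have t0s : t0 <= sup S by apply: ub_le_sup.
have st : sup S <= t by apply: ge_sup; [exists t0|move=> u [/andP[]]].
have fs : f (sup S) = 0.
  apply: contrapT => /eqP fs0.
  have /nbhs_ballP[e /= e0 ball_f] : \forall u \near sup S, f u != 0.
    by apply: (cvgr_neq0 (f (sup S)) (cf (sup S))) fs0.
  have [u Su su] := sup_adherent e0 (conj (ex_intro _ _ S0) ubS).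
  have us := ub_le_sup ubS Su.
  case: Su => _ /eqP; apply/negP; apply: ball_f.
  by rewrite /ball /= ger0_norm ?subr_ge0// ltrBlDr -ltrBlDl.
exists (sup S); split=> //.
  by rewrite lt_neqAle st andbT; apply: contra_neq ftn0 => <-.
move=> u /andP[su ut]; apply/eqP => fu.
have /(ub_le_sup ubS) : S u by split=> //; rewrite ut (le_trans t0s) ?ltW.
by rewrite leNgt su.
Qed.

Lemma derive_gt0_left (R : realType) (f : R -> R) (x df : R) :
  is_derive x 1 f df -> 0 < df -> \forall y \near x^'-, f y < f x.
Proof.
move=> [dfx <-] df0.
have : \forall h \near 0^', 0 < h^-1 *: (f (h *: 1 + x) - f x).
  by apply: cvgr_gt df0; exact: dfx.
move=> /nbhs_ballP[e /= e0 ball_e].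
near=> y.
have yx : y < x by near: y; exact: nbhs_left_lt.
have xey : x - e < y by near: y; apply: nbhs_left_gt; rewrite ltrBlDr ltrDl.
have /(_ _)/= := ball_e (y - x).
rewrite /ball /= sub0r normrN ltr0_norm ?subr_lt0// opprB ltrBlDr -ltrBlDl.
rewrite xey subr_eq0 lt_eqF// => /(_ isT isT).
rewrite /GRing.scale /= mulr1 subrK nmulr_rgt0 ?invr_lt0 ?subr_lt0//.
Unshelve. all: by end_near. Qed.

Lemma continuous_bigmin (R : realType) (I : finType) (i0 : I) (Q : I -> R -> R) :
  (forall i, continuous (Q i)) ->
  continuous (fun t => \big[Order.min/Q i0 t]_i Q i t).
Proof.
move=> cQ; elim: (index_enum I) => [|i s IHs].
  by under eq_fun do rewrite big_nil; exact: cQ.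
under eq_fun do rewrite big_cons.
by move=> x; apply: continuous_min; [exact: cQ|exact: IHs].
Qed.

Lemma continuous_bigmax (R : realType) (I : finType) (i0 : I) (Q : I -> R -> R) :
  (forall i, continuous (Q i)) ->
  continuous (fun t => \big[Order.max/Q i0 t]_i Q i t).
Proof.
move=> cQ; elim: (index_enum I) => [|i s IHs].
  by under eq_fun do rewrite big_nil; exact: cQ.
under eq_fun do rewrite big_cons.
by move=> x; apply: continuous_max; [exact: cQ|exact: IHs].
Qed.

Lemma bigmin_attained (R : realType) (I : finType) (i0 : I) (f : I -> R) :
  exists i, \big[Order.min/f i0]_i f i = f i.
Proof.
apply: (big_ind (fun x => exists i, x = f i)) => [|x y|i _]; last by exists i.
- by exists i0.
- by move=> [i ->] [j ->]; case: leP => _; [exists i|exists j].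
Qed.

Lemma bigmax_attained (R : realType) (I : finType) (i0 : I) (f : I -> R) :
  exists i, \big[Order.max/f i0]_i f i = f i.
Proof.
apply: (big_ind (fun x => exists i, x = f i)) => [|x y|i _]; last by exists i.
- by exists i0.
- by move=> [i ->] [j ->]; case: leP => _; [exists j|exists i].
Qed.

(** [A] and [B] are the clocks of [u] and [l], and the hypothesis on
    [u t - l z] bounds the growth of the lag [t - z] between times at which the
    clocks agree.  The barrier [e exp (k t)] dominates this lag for every small
    [e > 0]: where [A t - B (t - e exp (k t))] first vanishes its derivative
    would be positive. *)
Lemma clock_comparison (R : realType) (a c l0 T : R) (u l A B : R -> R) :
  0 < c -> 0 < l0 -> 0 <= a ->
  (forall t : R, l0 <= u t) -> (forall t : R, 0 < l t) ->
  (forall t : R, -1 < t -> is_derive t 1 A (c / u t)) ->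
  (forall t : R, -1 < t -> is_derive t 1 B (c / l t)) ->
  (forall t : R, 0 <= t -> 0 <= A t) -> (forall t : R, -1 < t -> t < 0 -> B t < 0) ->
  A 0 = 0 ->
  (forall z t : R, 0 <= z <= t -> t <= T -> B z = A t -> u t - l z <= a * (t - z)) ->
  forall t : R, 0 <= t <= T -> B t <= A t.
Proof.
move=> c0 l00 a0 u_ge l_gt dA dB A_ge B_lt A0 key.
(* With this rate, the barrier outgrows the lag: a * del < u * (k * del). *)
pose k := (a + 1) / l0.
have k0 : 0 < k by rewrite divr_gt0// ltr_wpDl.
pose del e t := e * expR (k * t).
have small (e t : R) : 0 < e < expR (- (k * T)) -> t <= T -> 0 < del e t < 1.
  move=> /andP[e0 e1] tT; rewrite /del mulr_gt0 ?expR_gt0//=.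
  apply: (@lt_le_trans _ _ (expR (- (k * T)) * expR (k * t))).
    by rewrite ltr_pM2r// expR_gt0.
  by rewrite -expRD -[leRHS]expR0 ler_expR addrC subr_le0 ler_pM2l.
pose D e t := A t - B (t - del e t).
have dD (e t : R) : 0 < e < expR (- (k * T)) -> 0 <= t <= T ->
    is_derive t 1 (D e)
      (c / u t - c / l (t - del e t) * (1 - e * (expR (k * t) * k))).
  move=> eT /andP[t0 tT]; have /andP[del0 del1] := small _ _ eT tT.
  apply: is_deriveB.
    by apply: dA; rewrite (lt_le_trans _ t0)// ltrN10.
  apply: (@is_derive1_chain _ B (fun t => t - del e t)); last first.
    by apply: dB; rewrite ltrBrDr (lt_le_trans _ t0)// addrC subr_lt0.
  apply: is_deriveB; apply: (@is_deriveZ _ _ _ (fun t => expR (k * t)) e).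
  apply: (@is_derive1_chain _ expR (fun t => k * t)).
  rewrite -[X in is_derive _ _ _ X]mulr1; exact: (@is_deriveZ _ _ _ id k).
have D_gt0 (e t : R) : 0 < e < expR (- (k * T)) -> 0 <= t <= T -> 0 < D e t.
  move=> eT /[dup] /andP[t0 tT]; have T0 := le_trans t0 tT; move: t {t0 tT}.
  have cD t : 0 <= t <= T -> {for t, continuous (D e)}.
    move=> tT; have [dDt _] := dD e t eT tT.
    exact/differentiable_continuous/derivable1_diffP.
  apply: real_induction => [|t tT Dt|t /andP[t0 tT] Dbelow].
  - have /andP[del0 del1] := small _ _ eT T0.
    rewrite /D A0 sub0r oppr_gt0 sub0r; apply: B_lt; first by rewrite ltrN2.
    by rewrite oppr_lt0.
  - exact: (cvgr_gt (D e t) (cD t tT)).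
  have tT' : 0 <= t <= T by rewrite ltW.
  have : 0 <= D e t.
    apply: (ge0_left_limit t0 (cD t tT')) => s s0t.
    exact/ltW/Dbelow.
  rewrite le_eqVlt => /predU1P[/esym Dt0|//].
  have /andP[del0 del1] := small _ _ eT tT.
  pose z := t - del e t.
  have Bz : B z = A t by apply/eqP; rewrite eq_sym -subr_eq0; exact/eqP.
  have z0 : 0 <= z.
    rewrite leNgt; apply/negP => z0; have := A_ge t (ltW t0).
    by rewrite -Bz leNgt B_lt// /z ltrBrDr addrC (lt_trans _ t0)// subr_lt0.
  have tz : t - z = del e t by rewrite /z; ring.
  have zt : z <= t by rewrite /z gerBl ltW.
  have := key z t; rewrite z0 zt tz => /(_ isT tT Bz) key_z.
  have := derive_gt0_left (dD e t eT tT') _.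
  have expk : e * (expR (k * t) * k) = k * del e t by rewrite /del; ring.
  have u0 := lt_le_trans l00 (u_ge t).
  have rate : u t * (1 - k * del e t) < l z.
    have : (a + 1) * del e t <= u t * (k * del e t).
      rewrite mulrA ler_pM2r// /k mulrCA -[leLHS]mulr1 ler_wpM2l ?addr_ge0//.
      by rewrite ler_pdivlMr// mul1r.
    by move: key_z; rewrite -/z; lra.
  rewrite expk -/z subr_gt0 => Dleft_of.
  have {}Dleft_of : \forall y \near t^'-, D e y < D e t.
    apply: Dleft_of.
    by rewrite -mulrA ltr_pM2l// ltr_pdivrMl// ltr_pdivlMr// mulrC.
  have [y [/= Dy y0 yt]] : exists y, [/\ D e y < D e t, 0 < y & y < t].
    apply: (@filter_ex _ (t^'-)); near=> y; split; near: y => //.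
    - exact: nbhs_left_gt.
    - exact: nbhs_left_lt.
  by move: Dy; rewrite Dt0 ltNge ltW// Dbelow// yt ltW.
move=> t /andP[t0 tT]; rewrite leNgt; apply/negP => AB.
have T0 := le_trans t0 tT.
have cB : {for t, continuous B}.
  have [dBt _] := dB t (lt_le_trans (ltrN10 R) t0).
  exact/differentiable_continuous/derivable1_diffP.
have nearB : \forall y \near t^'-, A t < B y.
  by apply: (cvgr_gt (B t)) AB; exact: cvg_at_left_filter.
pose r := expR (- (k * T)) * expR (k * t).
have [y [/= ABy yt ry]] : exists y, [/\ A t < B y, y < t & t - r < y].
  apply: (@filter_ex _ (t^'-)); near=> y; split; near: y => //.
  - exact: nbhs_left_lt.
  - by apply: nbhs_left_gt; rewrite ltrBlDr ltrDl mulr_gt0// expR_gt0.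
have := D_gt0 ((t - y) / expR (k * t)) t.
rewrite divr_gt0 ?subr_gt0 ?expR_gt0// ltr_pdivrMr ?expR_gt0//.
rewrite ltrBlDr -ltrBlDl ry t0 tT => /(_ isT isT).
have expn0 : expR (k * t) != 0 by rewrite gt_eqF// expR_gt0.
by rewrite /D /del divfK// subKr ltNge ltW.
Unshelve. all: by end_near. Qed.

(** * Coupled fluid queues *)

Section Coupling.
Context d (T : measurableType d) (R : realType) (P : probability T R).
Variables (X Y : {RV P >-> R}) (I : finType) (Q r : I -> R -> R) (a c q0 : R).
Hypothesis X_ge0 : forall w, 0 <= X w.
Hypotheses (a_gt0 : 0 < a) (c_gt0 : 0 < c).
Hypothesis Q_cont : forall i, continuous (Q i).
Hypothesis Q_ge0 : forall i t, 0 <= Q i t.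
Hypothesis r_zero : forall i (u : R), 0 <= u -> Q i u = 0 -> r i u = 0.
Hypothesis r_lb : forall i (u m : R), 0 <= u -> 0 < Q i u ->
  (forall k, Q k u <= m) -> c / m <= r i u.
Hypothesis r_ub : forall i (u m : R), 0 <= u -> 0 < m ->
  (forall k, m <= Q k u) -> r i u <= c / m.
Hypothesis Q_init : forall i, Q i 0 = q0.
Hypothesis Q_fluid : forall i (t : R), 0 <= t ->
  ((Q i t)%:E = q0%:E * survival Y (service (r i) 0 t)
    + a%:E * \int[lebesgue_measure]_(s in `[0%R, t])
               survival X (service (r i) s t))%E.

Lemma rate_ge0 i (u : R) : 0 <= u -> 0 <= r i u.
Proof.
move=> u0; have := Q_ge0 i u; rewrite le_eqVlt => /predU1P[/esym Qu|Qu].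
  by rewrite r_zero.
apply: le_trans (r_lb (m := \sum_k Q k u) u0 Qu _).
  by rewrite divr_ge0 ?(ltW c_gt0)// sumr_ge0.
by move=> k; rewrite (bigD1 k)//= lerDl sumr_ge0.
Qed.

Lemma service_mono i (s s' t t' : R) : 0 <= s' -> s' <= s -> t <= t' ->
  (service (r i) s t <= service (r i) s' t')%E.
Proof.
move=> s'0 s's tt'.
have sub : `[s, t] `<=` `[s', t'].
  by apply: subset_itv; rewrite bnd_simp.
apply: le_integral_subset => [//|u|u|//]; rewrite /= ?in_itv/= => /andP[su _];
  by rewrite lee_fin rate_ge0// (le_trans s'0)// (le_trans s's).
Qed.

Let remaining i t s := survival X (service (r i) s t).

Lemma measurable_remaining i t (D : set R) : measurable D -> D `<=` `[0, t] ->
  measurable_fun D (remaining i t).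
Proof.
move=> mD D0t.
pose h s := fine (remaining i t (Order.max 0 s)).
have mh : measurable_fun D h.
  apply: nondecreasing_measurable => // x y xy; rewrite /h fine_le ?survival_fin_num//.
  apply/survival_antitone/service_mono => //; first by rewrite le_max lexx.
  by rewrite ge_max !le_max lexx xy orbT.
apply: (eq_measurable_fun (EFin \o h)); last exact/measurable_EFinP.
move=> s /set_mem /D0t; rewrite /= in_itv/= => /andP[s0 _].
by rewrite /h max_r// fineK// survival_fin_num.
Qed.

(** The equation writes [Q i t = 0] as a sum of nonnegative terms; the integrand
    vanishes almost everywhere, and everywhere below [t] since it is
    nondecreasing in [s]. *)
Lemma remaining_eq0 i (t s : R) : 0 <= s -> s < t -> Q i t = 0 -> remaining i t s = 0%E.
Proof.
move=> s0 st Qt; have t0 : 0 <= t by rewrite (le_trans s0)// ltW.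
have := Q_fluid i t0; rewrite Qt => /esym/eqP.
have q00 : 0 <= q0 by rewrite -(Q_init i).
rewrite padde_eq0; last 2 first.
- by rewrite mule_ge0// ?lee_fin// survival_ge0.
- rewrite mule_ge0 ?lee_fin ?(ltW a_gt0)//.
  by apply: integral_ge0 => u _; exact: survival_ge0.
move=> /andP[_]; rewrite mule_eq0 eqe gt_eqF//= => /eqP I0.
have [//|rem0] := eqVneq (remaining i t s) 0%E; exfalso.
have rem_gt0 : (0 < remaining i t s)%E by rewrite lt0e rem0 survival_ge0.
have : ((remaining i t s) * (t - s)%:E <= 0)%E.
  rewrite -I0; apply: cst_le_integral => // [|u|u _|u /andP[su _]].
  - exact: ltW.
  - by rewrite /= !in_itv/= => /andP[/ltW su ->]; rewrite (le_trans s0).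
  - exact: survival_ge0.
  - by apply/survival_antitone/service_mono => //; exact: ltW.
by rewrite leNgt mule_gt0// lte_fin subr_gt0.
Qed.

(** Everything that arrived before an empty instant has left, so a queue restarts
    from that instant with no memory of its past. *)
Lemma restart i (z t : R) : 0 <= z -> z <= t -> Q i z = 0 ->
  ((Q i t)%:E <= a%:E * \int[lebesgue_measure]_(s in `]z, t]) remaining i t s)%E.
Proof.
move=> z0 zt Qz; have t0 := le_trans z0 zt.
have q00 : 0 <= q0 by rewrite -(Q_init i).
have init0 : (q0%:E * survival Y (service (r i) 0 t) <= 0)%E.
  have initz : (q0%:E * survival Y (service (r i) 0 z) = 0)%E.
    have := Q_fluid i z0; rewrite Qz => /esym/eqP.
    rewrite padde_eq0 => [/andP[/eqP//]||].
    - by rewrite mule_ge0// ?lee_fin// survival_ge0.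
    - rewrite mule_ge0 ?lee_fin ?(ltW a_gt0)//.
      by apply: integral_ge0 => u _; exact: survival_ge0.
  rewrite -initz lee_wpmul2l// survival_antitone//.
  exact: service_mono.
rewrite (Q_fluid i t0) -[leRHS]add0e leeD// lee_wpmul2l ?lee_fin ?(ltW a_gt0)//.
rewrite (@itv_bndbnd_setU _ _ _ (BLeft z)) ?bnd_simp//.
rewrite ge0_integral_setU//=; first last.
- rewrite disj_set2E; apply/eqP; rewrite -subset0 => u [] /=.
  by rewrite !in_itv/= => /andP[_ uz] /andP[]; rewrite leNgt uz.
- by move=> u _; exact: survival_ge0.
- apply: measurable_remaining; first exact: measurableU.
  move=> u [] /=; rewrite !in_itv/= => /andP[l1 l2].
    by rewrite l1 (le_trans (ltW l2)).
  by rewrite l2 (le_trans z0).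
rewrite integral0_eq ?add0e => [|u /=].
  rewrite integral_itv_obnd_cbnd//; apply: measurable_remaining => // u /=.
  by rewrite !in_itv/= => /andP[/ltW zu ->]; rewrite (le_trans z0).
rewrite in_itv/= => /andP[u0 uz]; apply/eqP.
rewrite eq_le survival_ge0 andbT -(remaining_eq0 u0 uz Qz).
by apply: survival_antitone; exact: service_mono.
Qed.

Lemma fluid_ge i (z t : R) : 0 <= z -> z <= t ->
  (a%:E * \int[lebesgue_measure]_(s in `]z, t]) remaining i t s <= (Q i t)%:E)%E.
Proof.
move=> z0 zt; rewrite (Q_fluid i (le_trans z0 zt)) -[leLHS]add0e leeD//.
  by rewrite mule_ge0 ?survival_ge0// lee_fin -(Q_init i).
rewrite lee_wpmul2l ?lee_fin ?(ltW a_gt0)//.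
apply: le_integral_subset => [u|u _|u _|u _]; try exact: survival_ge0.
  by rewrite /= !in_itv/= => /andP[/ltW zu ->]; rewrite (le_trans z0).
exact: lexx.
Qed.

Lemma integral_remaining_le i (z t : R) : z <= t ->
  (\int[lebesgue_measure]_(s in `]z, t]) remaining i t s <= (t - z)%:E)%E.
Proof.
rewrite le_eqVlt => /predU1P[<-|zt].
  by rewrite set_itvoc0 integral_set0 subrr.
have -> : ((t - z)%:E = \int[lebesgue_measure]_(u in `]z, t]) 1 :> \bar R)%E.
  by rewrite integral_cst//= mul1e lebesgue_measure_itv/= lte_fin zt EFinB.
apply: le_integral_subset => [//|u _|u _|u _]; first exact: survival_ge0.
  exact: lee01.
exact: survival_le1.
Qed.

(** An empty queue is not served, so it cannot remain empty on an interval
    during which it receives jobs of positive size. *)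
Lemma sometimes_positive i (z t : R) : (0 < survival X 0)%E -> 0 <= z -> z < t ->
  exists2 u, z < u <= t & 0 < Q i u.
Proof.
move=> S0 z0 zt; apply: contrapT => noQ.
have Qu0 u : z < u <= t -> Q i u = 0.
  move=> zut; apply/eqP; rewrite eq_le Q_ge0 andbT leNgt.
  by apply/negP => Qu; apply: noQ; exists u.
have := fluid_ge i z0 (ltW zt); rewrite Qu0 ?zt ?lexx// leNgt.
move=> /negP; apply; rewrite mule_gt0 ?lte_fin//.
apply: (@lt_le_trans _ _ (survival X 0 * (t - z)%:E)%E).
  by rewrite mule_gt0// lte_fin subr_gt0.
apply: cst_le_integral => // [|u _|u /andP[zu ut]].
- exact: ltW.
- exact: survival_ge0.
rewrite /remaining (_ : service _ _ _ = 0%E)//; apply: integral0_eq => v.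
rewrite /= in_itv/= => /andP[uv vt]; rewrite r_zero//.
  by rewrite (le_trans z0)// (le_trans (ltW zu)).
by rewrite Qu0// vt andbT (lt_le_trans zu).
Qed.

(** Positivity of each queue holds on a dense open set, and there are finitely
    many queues. *)
Lemma all_positive_near (z t : R) : (0 < survival X 0)%E -> 0 <= z -> z < t ->
  exists2 u, z < u < t & forall i, 0 < Q i u.
Proof.
move=> S0 z0 zt.
suff [x [y [zx xy yt Qxy]]] : exists x y, [/\ z <= x, x < y, y <= t &
    forall i, i \in enum I -> forall u, x < u < y -> 0 < Q i u].
  exists ((x + y) / 2).
    by rewrite (le_lt_trans zx) ?midf_lt// (lt_le_trans _ yt) ?midf_lt.
  by move=> i; apply: Qxy; rewrite ?mem_enum// !midf_lt.
elim: (enum I) => [|i s [x [y [zx xy yt Qxy]]]].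
  by exists z, t.
have [|u xuy Qu] := @sometimes_positive i x ((x + y) / 2) S0 (le_trans z0 zx).
  by rewrite midf_lt.
have /nbhs_ballP[e /= e0 ball_e] : \forall v \near u, 0 < Q i v.
  by apply: (cvgr_gt (Q i u) (@Q_cont i u)).
have uy : u < y by case/andP: xuy => _ /le_lt_trans; apply; rewrite midf_lt.
exists u, (Order.min y (u + e)); split.
- by case/andP: xuy => /ltW /(le_trans zx).
- by rewrite lt_min uy ltrDl.
- by rewrite ge_min yt.
move=> j; rewrite inE => /orP[/eqP ->|js] v /andP[uv].
  rewrite lt_min => /andP[_ ve]; apply: ball_e.
  by rewrite /ball /= ltr0_norm ?subr_lt0// opprB ltrBlDl.
rewrite lt_min => /andP[vy _]; apply: Qxy => //.
by rewrite vy andbT (lt_trans _ uv)//; case/andP: xuy.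
Qed.

Let J := laplace_defect X.

(** After its last empty instant [y] the queue is served at least at the rate
    [c / (m (u - z))], and what arrived before [y] has left. *)
Lemma zero_start_bound i (z t m : R) : 0 <= z -> z < t -> 0 < m ->
  (forall k, Q k z = 0) -> (forall k u, z <= u -> Q k u <= m * (u - z)) ->
  Q i t <= a * ((t - z) * J (m / c)).
Proof.
move=> z0 zt m0 Qz Qm.
have [->|Qt] := eqVneq (Q i t) 0.
  by rewrite !mulr_ge0 ?laplace_defect_ge0 ?divr_ge0 ?subr_ge0 ?ltW.
have [y [zy yt Qy Qyt]] := last_zero (@Q_cont i) (ltW zt) (Qz i) Qt.
have y0 := le_trans z0 zy.
rewrite -lee_fin (le_trans (restart y0 (ltW yt) Qy))// EFinM.
rewrite lee_wpmul2l ?lee_fin ?(ltW a_gt0)// -invf_div.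
rewrite -integral_survival_log ?divr_gt0//.
apply: le_integral_subset => [u|u _|u _|u]; try exact: survival_ge0.
  by rewrite /= !in_itv/= => /andP[yu ->]; rewrite (le_lt_trans zy).
rewrite /= in_itv/= => /andP[yu ut]; apply: survival_antitone.
apply: service_log_le => //; first by rewrite divr_ge0 ?ltW.
  exact: le_lt_trans yu.
move=> v /andP[uv vt]; have yv := lt_le_trans yu uv.
have zv := le_lt_trans zy yv.
rewrite -mulrA -invfM; apply: r_lb => [||k].
- exact: le_trans (ltW zv).
- by rewrite lt_neqAle eq_sym Qyt ?yv//= Q_ge0.
- exact/Qm/ltW.
Qed.

(** The constant is the supremum of [Q i t / (t - z)], finite because it is at
    most the arrival rate.  [zero_start_bound] reproduces the linear bound with
    constant [a * J (m / c)], which therefore cannot be smaller. *)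
Lemma zero_start_growth (i0 : I) (z : R) : (0 < survival X 0)%E -> 0 <= z ->
  (forall k, Q k z = 0) ->
  exists2 m, 0 < m <= a * J (m / c) &
    forall i t, z <= t -> Q i t <= m * (t - z).
Proof.
move=> S0 z0 Qz.
pose S := [set x | exists i t, z < t /\ x = Q i t / (t - z)].
have Sa x : S x -> x <= a.
  move=> [i [t [zt ->]]]; rewrite ler_pdivrMr ?subr_gt0// -lee_fin.
  rewrite (le_trans (restart z0 (ltW zt) (Qz i)))// EFinM.
  rewrite lee_wpmul2l ?lee_fin ?(ltW a_gt0)//.
  exact/integral_remaining_le/ltW.
have ubS : has_ubound S by exists a => x; exact: Sa.
have Qm i t : z <= t -> Q i t <= sup S * (t - z).
  rewrite le_eqVlt => /predU1P[<-|zt]; first by rewrite subrr mulr0 Qz.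
  rewrite -ler_pdivrMr ?subr_gt0//; apply: ub_le_sup => //.
  by exists i, t.
have m0 : 0 < sup S.
  have z1 : z < z + 1 by rewrite ltrDl.
  have [t /andP[zt _] /(_ i0) Qt] := all_positive_near S0 z0 z1.
  apply: (@lt_le_trans _ _ (Q i0 t / (t - z))).
    by rewrite divr_gt0// subr_gt0.
  by apply: ub_le_sup => //; exists i0, t.
exists (sup S) => //; rewrite m0; apply: ge_sup.
  by exists (Q i0 (z + 1) / (z + 1 - z)), i0, (z + 1); rewrite ltrDl ltr01.
move=> x [i [t [zt ->]]]; rewrite ler_pdivrMr ?subr_gt0//.
by rewrite -mulrA (mulrC (J _)); exact: zero_start_bound.
Qed.

(** At the first time when some queue touches the line, all queues have been
    above it, so that queue was served at most at the rate [c / (m (u - z))] and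
    holds at least [a (t - z) J (m / c)], which exceeds [m (t - z)]. *)
Lemma linear_lower (z m : R) : 0 <= z -> 0 < m < a * J (m / c) ->
  (forall i, 0 < Q i z) -> forall i t, z <= t -> m * (t - z) < Q i t.
Proof.
move=> z0 /andP[m0 mJ] Qz i t zt; move: i.
apply: (@real_induction _ (fun t => forall i, m * (t - z) < Q i t) z t);
  rewrite ?zt ?lexx//.
- by move=> i; rewrite subrr mulr0.
- move=> u _ Qu; suff near_i i : \forall v \near u, m * (v - z) < Q i v.
    exact: (@filter_forall _ _ (fun i v => m * (v - z) < Q i v) (nbhs u)).
  have cf : {for u, continuous (fun v => Q i v - m * (v - z))}.
    apply: cvgB; first exact: Q_cont.
    by apply: cvgM; [exact: cvg_cst|apply: cvgB; [exact: cvg_id|exact: cvg_cst]].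
  have := cvgr_gt _ cf 0; rewrite subr_gt0 => /(_ _ (Qu i)).
  by apply: filterS => v; rewrite subr_gt0.
move=> u /andP[zu ut] below i.
have mQ v k : z <= v <= u -> m * (v - z) <= Q k v.
  move=> /andP[zv]; rewrite le_eqVlt => /predU1P[->|vu]; last first.
    by apply/ltW/below; rewrite zv.
  rewrite -subr_ge0.
  apply: (ge0_left_limit (f := fun v => Q k v - m * (v - z)) zu) => [|s zsu].
    apply: cvgB; first exact: Q_cont.
    by apply: cvgM; [exact: cvg_cst|apply: cvgB; [exact: cvg_id|exact: cvg_cst]].
  by rewrite subr_ge0; exact/ltW/below.
apply: (@lt_le_trans _ _ (a * ((u - z) * J (m / c)))).
  by rewrite mulrCA mulrC ltr_pM2l// subr_gt0.
rewrite -lee_fin (le_trans _ (fluid_ge i z0 (ltW zu)))// EFinM.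
rewrite lee_wpmul2l ?lee_fin ?(ltW a_gt0)// -invf_div.
rewrite -integral_survival_log ?divr_gt0//.
apply: le_integral_subset => [//|s _|s _|s]; try exact: survival_ge0.
rewrite /= in_itv/= => /andP[zs su]; apply: survival_antitone.
apply: service_le_log => // v /andP[sv vu].
have zv := lt_le_trans zs sv; have v0 := le_trans z0 (ltW zv).
rewrite rate_ge0//= -mulrA -invfM; apply: r_ub => // [|k].
  by rewrite mulr_gt0// subr_gt0.
by apply: mQ; rewrite (ltW zv).
Qed.

Lemma slower_growth (m m' : R) : (0 < survival X 0)%E -> 0 < m' -> m' < m ->
  m <= a * J (m / c) -> m' < a * J (m' / c).
Proof.
move=> S0 m'0 m'm mJ; have m0 := lt_trans m'0 m'm.
have := laplace_defect_concave X_ge0 (k := m / c) (k' := m' / c).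
rewrite divr_gt0// ltr_pM2r ?invr_gt0// => /(_ isT m'm S0).
rewrite -/J mulrAC [X in _ < X]mulrAC ltr_pM2r ?invr_gt0// => JJ.
rewrite -(ltr_pM2l m0) (le_lt_trans (y := m' * (a * J (m / c))))//.
  by rewrite mulrC ler_pM2l.
by rewrite mulrCA [ltRHS]mulrCA ltr_pM2l.
Qed.

(** The queues are clamped to [[0, S]] so that their extrema become continuous and
    positive on the whole line, as the clocks require. *)
Lemma equal_while_positive (S : R) :
  (forall i (u : R), 0 <= u <= S -> 0 < Q i u) ->
  forall i j (t : R), 0 <= t <= S -> Q i t <= Q j t.
Proof.
move=> Qpos i j t0 t0S; have S0 : 0 <= S by case/andP: t0S; exact: le_trans.
pose clamp (t : R) := Order.min (Order.max t 0) S.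
have clampE t : 0 <= t <= S -> clamp t = t.
  by move=> /andP[t_ge tS]; rewrite /clamp max_l// min_l.
have clamp0S t : 0 <= clamp t <= S.
  by rewrite /clamp le_min le_max lexx orbT S0 ge_min lexx orbT.
have clamp_cont : continuous clamp.
  apply: (@min_fun_continuous _ R R (fun t => Order.max t 0) (cst S)).
    by apply: (@max_fun_continuous _ R R id (cst 0)) => x; [exact: cvg_id|exact: cvg_cst].
  by move=> x; exact: cvg_cst.
pose hi t := \big[Order.max/Q i t]_k Q k t.
pose lo t := \big[Order.min/Q i t]_k Q k t.
have Q_hi k t : Q k t <= hi t by exact: le_bigmax_cond.
have lo_Q k t : lo t <= Q k t by exact: bigmin_le_cond.
pose u t := hi (clamp t); pose l t := lo (clamp t).
have u_cont : continuous u.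
  move=> t; apply: continuous_comp; first exact: clamp_cont.
  exact: (@continuous_bigmax R I i Q Q_cont).
have l_cont : continuous l.
  move=> t; apply: continuous_comp; first exact: clamp_cont.
  exact: (@continuous_bigmin R I i Q Q_cont).
have l_gt0 t : 0 < l t.
  by rewrite /l /lo; have [k ->] := bigmin_attained i (Q^~ (clamp t)); exact: Qpos.
have lu t : l t <= u t by exact: le_trans (lo_Q i _) (Q_hi i _).
have u_gt0 t : 0 < u t by exact: lt_le_trans (lu t).
have [w wS l_min] := EVT_min S0 (continuous_subspaceT l_cont).
have l_ge t : l w <= l t.
  have -> : l t = l (clamp t) by rewrite {2}/l clampE.
  by apply: l_min; rewrite in_itv/=.
have inv_cont (f : R -> R) : continuous f -> (forall t, 0 < f t) ->
    continuous (fun t => c / f t).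
  move=> cf f0 t; apply: cvgM; first exact: cvg_cst.
  by apply: cvgV; [rewrite gt_eqF|exact: cf].
have [A [A0 dA A_inc]] := increasing_primitive (inv_cont u u_cont u_gt0)
  (fun t => divr_gt0 c_gt0 (u_gt0 t)).
have [B [B0 dB B_inc]] := increasing_primitive (inv_cont l l_cont l_gt0)
  (fun t => divr_gt0 c_gt0 (l_gt0 t)).
have service_ge k (s t : R) : 0 <= s -> s <= t -> t <= S ->
    ((A t - A s)%:E <= service (r k) s t)%E.
  move=> s0 st tS.
  have <- : (\int[lebesgue_measure]_(x in `[s, t]) (c / u x)%:E = (A t - A s)%:E)%E.
    apply: integral_primitive => // [x /andP[sx _]|x _]; last exact: inv_cont.
    by apply: dA; apply: lt_le_trans sx; rewrite (lt_le_trans _ s0)// ltrN10.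
  apply: le_integral_subset => [//|x _|x|x].
  - by rewrite lee_fin divr_ge0 ?(ltW c_gt0) ?(ltW (u_gt0 _)).
  - rewrite /= in_itv/= => /andP[sx _]; rewrite lee_fin rate_ge0//.
    exact: le_trans sx.
  - rewrite /= in_itv/= => /andP[sx xt]; rewrite lee_fin.
    have xS : 0 <= x <= S by rewrite (le_trans s0)// (le_trans xt).
    apply: r_lb => [||k']; [by case/andP: xS|exact: Qpos|].
    by rewrite /u clampE.
have service_le k (s t : R) : 0 <= s -> s <= t -> t <= S ->
    (service (r k) s t <= (B t - B s)%:E)%E.
  move=> s0 st tS.
  have <- : (\int[lebesgue_measure]_(x in `[s, t]) (c / l x)%:E = (B t - B s)%:E)%E.
    apply: integral_primitive => // [x /andP[sx _]|x _]; last exact: inv_cont.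
    by apply: dB; apply: lt_le_trans sx; rewrite (lt_le_trans _ s0)// ltrN10.
  apply: le_integral_subset => [//|x|x _|x].
  - rewrite /= in_itv/= => /andP[sx _]; rewrite lee_fin rate_ge0//.
    exact: le_trans sx.
  - by rewrite lee_fin divr_ge0 ?(ltW c_gt0) ?(ltW (l_gt0 _)).
  - rewrite /= in_itv/= => /andP[sx xt]; rewrite lee_fin.
    have xS : 0 <= x <= S by rewrite (le_trans s0)// (le_trans xt).
    apply: r_ub => [|//|k']; first by case/andP: xS.
    by rewrite /l clampE.
have AB (t : R) : 0 <= t <= S -> A t <= B t.
  move=> /andP[t_ge tS]; rewrite -[A t]subr0 -[B t]subr0 -{1}A0 -{2}B0 -lee_fin.
  exact: le_trans (service_ge i _ _ _ _ _) (service_le i _ _ _ _ _).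
have key k k' (z t : R) : 0 <= z <= t -> t <= S -> B z = A t ->
    Q k t - Q k' z <= a * (t - z).
  move=> /andP[z0 zt] tS BA; have t_ge := le_trans z0 zt.
  have zS := le_trans zt tS.
  have later s : 0 <= s -> s <= z -> (service (r k') s z <= service (r k) s t)%E.
    move=> s0 sz; apply: le_trans (service_le k' _ _ s0 sz zS) _.
    apply: le_trans (service_ge k _ _ s0 (le_trans sz zt) tS).
    by rewrite lee_fin BA lerB// AB// s0 (le_trans sz).
  rewrite lerBlDl -lee_fin EFinD (Q_fluid k t_ge) (Q_fluid k' z0).
  rewrite -addeA; apply: leeD.
    rewrite lee_wpmul2l ?lee_fin -?(Q_init i)//.
    exact/survival_antitone/later.
  rewrite EFinM -ge0_muleDr ?lee_fin ?subr_ge0//; last first.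
    by apply: integral_ge0 => s _; exact: survival_ge0.
  rewrite lee_wpmul2l ?lee_fin ?(ltW a_gt0)//.
  rewrite (@itv_bndbnd_setU _ _ _ (BRight z)) ?bnd_simp//.
  rewrite ge0_integral_setU//=; first last.
  - rewrite disj_set2E; apply/eqP; rewrite -subset0 => x [] /=.
    by rewrite !in_itv/= => /andP[_ xz] /andP[]; rewrite ltNge xz.
  - by move=> x _; exact: survival_ge0.
  - apply: (measurable_remaining k (t := t)); first exact: measurableU.
    move=> x [] /=; rewrite !in_itv/= => /andP[l1 l2].
      by rewrite l1 (le_trans l2).
    by rewrite l2 andbT (le_trans z0)// ltW.
  apply: leeD; last exact: integral_remaining_le.
  apply: le_integral_subset => [//|x _|x _|x]; try exact: survival_ge0.
  by rewrite /= in_itv/= => /andP[x0 xz]; exact/survival_antitone/later.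
have BA : B t0 <= A t0.
  apply: (clock_comparison c_gt0 (l_gt0 w) (ltW a_gt0) _ l_gt0 dA dB _ _ A0 _ t0S).
  - by move=> t; exact: le_trans (l_ge t) (lu t).
  - move=> t; rewrite le_eqVlt => /predU1P[<-|t_gt]; first by rewrite A0.
    by rewrite -A0 ltW// A_inc// ltrN10.
  - by move=> t t1 t_lt; rewrite -B0 B_inc.
  - move=> z t /andP[z0 zt] tS BzA.
    rewrite /u /l !clampE ?z0 ?(le_trans zt) ?(le_trans z0)//.
    rewrite /hi /lo; have [k ->] := bigmax_attained i (Q^~ t).
    have [k' ->] := bigmin_attained i (Q^~ z).
    by apply: key => //; rewrite z0.
have BAeq : B t0 = A t0 by apply/eqP; rewrite eq_le BA AB.
have := key i j t0 t0; rewrite lexx; case/andP: t0S => -> tS /(_ isT tS BAeq).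
by rewrite subrr mulr0 subr_le0.
Qed.

(** When [X] is 0 almost surely, arrivals leave at once. *)
Lemma extinction i (z t : R) : survival X 0 = 0%E -> 0 <= z -> z <= t ->
  Q i z = 0 -> Q i t = 0.
Proof.
move=> S0 z0 zt Qz; apply/eqP; rewrite eq_le Q_ge0 andbT -lee_fin.
rewrite (le_trans (restart z0 zt Qz))// integral0_eq ?mule0// => s.
rewrite /= in_itv/= => /andP[zs _]; apply/eqP.
rewrite eq_le survival_ge0 andbT -[leRHS]S0; apply: survival_antitone.
apply: integral_ge0 => u; rewrite /= in_itv/= => /andP[su _].
by rewrite lee_fin rate_ge0// (le_trans z0)// (le_trans (ltW zs)).
Qed.

(** If [Q j t < Q i t], the slope [m'] is taken between [Q j t / t] and the optimal
    [m], and the common positive instant [z] so small that [m' (t - z)] still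
    exceeds [Q j t]. *)
Lemma equal_from_empty i j (t : R) : q0 = 0 -> 0 <= t -> Q i t <= Q j t.
Proof.
move=> q00 t0; have Qz k : Q k 0 = 0 by rewrite Q_init.
have [S0|S0] := eqVneq (survival X 0) 0%E.
  by rewrite !(extinction S0 (lexx 0) t0 (Qz _)).
have {}S0 : (0 < survival X 0)%E by rewrite lt0e S0 survival_ge0.
have [m /andP[m0 mJ] Qm] := zero_start_growth i S0 (lexx 0) Qz.
rewrite leNgt; apply/negP => QjQi.
have Qjm : Q j t < m * t.
  by apply: lt_le_trans QjQi _; have := Qm i t t0; rewrite subr0.
have t_gt0 : 0 < t.
  by rewrite -(pmulr_rgt0 _ m0); exact: le_lt_trans (Q_ge0 j t) Qjm.
pose m' := (Q j t / t + m) / 2.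
have /midf_lt[Qm' m'm] : Q j t / t < m by rewrite ltr_pdivrMr.
have m'0 : 0 < m' by apply: le_lt_trans Qm'; rewrite divr_ge0// ltW.
have gap : 0 < t - Q j t / m'.
  by rewrite subr_gt0 ltr_pdivrMr// mulrC -ltr_pdivrMr.
have [z /andP[z0 zgap] Qpos] := all_positive_near S0 (lexx 0) gap.
have zt : z <= t.
  by rewrite (le_trans (ltW zgap))// gerBl divr_ge0// ltW.
have := @linear_lower z m' (ltW z0) _ Qpos j t zt.
rewrite m'0 (slower_growth S0 m'0 m'm mJ) => /(_ isT).
rewrite ltNge ltW// -ltr_pdivrMl// mulrC ltrBrDr addrC -ltrBrDr.
exact: zgap.
Qed.

(** Up to the first time [z] at which some queue is empty all queues agree, so
    they are all empty at [z]. *)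
Lemma equal_from_positive i j (t : R) : 0 < q0 -> 0 <= t -> Q i t <= Q j t.
Proof.
move=> q0_gt0 t0.
have [allpos|] := pselect (forall u, 0 <= u <= t -> forall k, 0 < Q k u).
  by apply: (@equal_while_positive t) => [k u /allpos|]; rewrite ?t0 ?lexx.
move=> nallpos.
have [z [/andP[z0 zt] below nz]] : exists z, [/\ 0 < z <= t,
    forall s, 0 <= s < z -> forall k, 0 < Q k s & ~ forall k, 0 < Q k z].
  apply: contrapT => nz; apply: nallpos.
  apply: real_induction => [k|u _ Qu|u u0t below].
  - by rewrite Q_init.
  - apply: (@filter_forall _ _ (fun k v => 0 < Q k v) (nbhs u)) => k.
    exact: (cvgr_gt _ (@Q_cont k u)).
  - by apply: contrapT => nu; apply: nz; exists u.
have Qle k l : Q k z <= Q l z.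
  rewrite -subr_ge0.
  apply: (ge0_left_limit (f := fun s => Q l s - Q k s) z0) => [|s /andP[s0 sz]].
    by apply: cvgB; exact: Q_cont.
  rewrite subr_ge0; apply: (@equal_while_positive s) => [h u /andP[u0 us]|].
    by apply: below; rewrite u0 (le_lt_trans us).
  by rewrite s0 lexx.
have Qz k : Q k z = 0.
  apply/eqP; rewrite eq_le Q_ge0 andbT leNgt; apply/negP => Qk.
  by apply: nz => l; exact: lt_le_trans (Qle k l).
have [S0|S0] := eqVneq (survival X 0) 0%E.
  by rewrite !(extinction S0 (ltW z0) zt (Qz _)).
have {}S0 : (0 < survival X 0)%E by rewrite lt0e S0 survival_ge0.
have [m /andP[m0 mJ] _] := zero_start_growth i S0 (ltW z0) Qz.
have m2 : 0 < m / 2 by rewrite divr_gt0.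
have m2m : m / 2 < m by rewrite ltr_pdivrMr// ltr_pMr// ltr1n.
have Qpos k : 0 < Q k 0 by rewrite Q_init.
have := @linear_lower 0 (m / 2) (lexx 0) _ Qpos i z (ltW z0).
rewrite m2 (slower_growth S0 m2 m2m mJ) Qz subr0 => /(_ isT).
by rewrite ltNge mulr_ge0// ltW.
Qed.

(** The hypotheses of the section are the only properties of the rates that the
    comparison uses: no service for empty queues, and service of the others
    between those of a single queue as large as the maximum and as small as the
    minimum. *)
Theorem coupled_queues_equal i j (t : R) : 0 <= t -> Q i t = Q j t.
Proof.
move=> t0; have : 0 <= q0 by rewrite -(Q_init i).
rewrite le_eqVlt => /predU1P[q00|q0_gt0]; apply/le_anti.
  by rewrite !equal_from_empty.
by rewrite !equal_from_positive.
Qed.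

End Coupling.

(** Freezing a function at its value at 0 makes it continuous on the whole line;
    fluid solutions are only continuous on the half-line. *)
Lemma continuous_constant_extension (R : realType) (f : R -> R) :
  {within `[0, +oo[, continuous f} -> continuous (fun t : R => f (Order.max t 0)).
Proof.
move=> cf t; pose y := Order.max t 0.
have y0 : `[0, +oo[%classic y by rewrite /= in_itv/= andbT le_max lexx orbT.
have fy : f @ within `[0, +oo[ (nbhs y) --> f y.
  by move/subspace_continuousP : cf; apply.
apply: (@cvg_comp _ _ _ (fun t : R => Order.max t 0) f (nbhs t) _ _ _ fy).
move=> U /= U_nbhs.
have max_cont : {for t, continuous (fun t : R => Order.max t 0)}.
  by apply: (@max_fun_continuous _ R R id (cst 0)) => x; [exact: cvg_id|exact: cvg_cst].
have U_near : \forall x \near y, `[0, +oo[%classic x -> U x by exact: U_nbhs.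
apply: (@filterS _ (nbhs t) _ _ _ _ (max_cont _ U_near)) => x; apply.
by rewrite /= in_itv/= andbT le_max lexx orbT.
Qed.

Lemma fluid_family_equal d (T : measurableType d) (R : realType)
    (P : probability T R) (X Y : {RV P >-> R}) (I : finType)
    (Q r : I -> R -> R) (a c q0 : R) :
  (forall w, 0 <= X w) -> 0 < a -> 0 < c ->
  (forall i, nonneg_continuous (Q i)) ->
  (forall i (u : R), 0 <= u -> Q i u = 0 -> r i u = 0) ->
  (forall i (u m : R), 0 <= u -> 0 < Q i u -> (forall k, Q k u <= m) ->
    c / m <= r i u) ->
  (forall i (u m : R), 0 <= u -> 0 < m -> (forall k, m <= Q k u) ->
    r i u <= c / m) ->
  (forall i, Q i 0 = q0) ->
  (forall i, fluid_equation a (ecdf X) (ecdf Y) (service (r i)) (Q i)) ->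
  forall i j (t : R), 0 <= t -> Q i t = Q j t.
Proof.
move=> X0 a0 c0 cQ rz rlb rub Qi Qf i j t t0.
pose Q' i (t : R) := Q i (Order.max t 0).
have Q'E k (u : R) : 0 <= u -> Q' k u = Q k u by move=> u0; rewrite /Q' max_l.
rewrite -!Q'E//; apply: (@coupled_queues_equal _ _ _ _ X Y I Q' r a c q0) => //.
- by move=> k; apply: continuous_constant_extension; case: (cQ k).
- by move=> k u; case: (cQ k) => _; apply; rewrite le_max lexx orbT.
- by move=> k u u0; rewrite Q'E//; exact: rz.
- by move=> k u m u0; rewrite Q'E// => Qu Qm; apply: rlb => // l; rewrite -Q'E.
- by move=> k u m u0 m0 Qm; apply: rub => // l; rewrite -Q'E.
- by move=> k; rewrite Q'E.
- by move=> k u u0; rewrite Q'E// (Qf k u u0) Qi.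
Qed.

(** * Service rates of the two systems *)

Section Subsets.
Variables (R : realType) (N d : nat) (s : 'I_('C(N, d)) -> {set 'I_N}).
Hypotheses (d_ge1 : (1 <= d)%N) (d_leN : (d <= N)%N) (s_enum : enum_subsets s).

(** The subsets that contain [j] are all [d]-subsets except those of the
    complement of [j]; Pascal's rule counts them. *)
Lemma card_containing (j : 'I_N) : #|[set k | j \in s k]%SET| = 'C(N.-1, d.-1).
Proof.
have [s_inj s_onto] := s_enum.
rewrite -(card_imset _ s_inj).
have -> : (s @: [set k | j \in s k] =
   [set A : {set 'I_N} | (A \subset [set: 'I_N]) && (#|A| == d)]
   :\: [set A : {set 'I_N} | (A \subset ~: [set j]) && (#|A| == d)])%SET.
  apply/setP => A; rewrite !inE finset.subsetT /= finset.subsetC finset.sub1set inE.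
  have [Ad|nAd] := eqVneq #|A| d.
    have [k <-] := (s_onto A).2 Ad.
    by rewrite mem_imset// inE !andbT negbK.
  rewrite !andbF; apply/imsetP => -[k _ Ak].
  by move/eqP: nAd; apply; apply/s_onto; exists k.
rewrite finset.cardsD (finset.setIidPr _); last first.
  by apply/fintype.subsetP => A; rewrite !inE finset.subsetT => /andP[_ ->].
rewrite !cards_draws cardsT cardsC1 card_ord.
move: d_ge1 d_leN; case: d => // d' _; case: N j => [[]//|N'] _ _ /=.
by rewrite binS addKn.
Qed.

Let K : R := 'C(N.-1, d.-1)%:R.

Lemma server_load_le (x : 'I_('C(N, d)) -> R) (m : R) j :
  (forall k, x k <= m) -> server_load s x j <= K * m.
Proof.
move=> xm; rewrite /K -(card_containing j) mulr_natl -sumr_const.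
rewrite /server_load (eq_bigl (fun k => k \in [set k | j \in s k]%SET)) => [|k].
  exact: ler_sum.
by rewrite inE.
Qed.

Lemma server_load_ge (x : 'I_('C(N, d)) -> R) (m : R) j :
  (forall k, m <= x k) -> K * m <= server_load s x j.
Proof.
move=> xm; rewrite /K -(card_containing j) mulr_natl -sumr_const.
rewrite /server_load [leRHS](eq_bigl (fun k => k \in [set k | j \in s k]%SET)) => [|k].
  exact: ler_sum.
by rewrite inE.
Qed.

Let K_gt0 : 0 < K.
Proof. by rewrite ltr0n bin_gt0 -!subn1 leq_sub2r. Qed.

Let s_neq0 i : s i != finset.set0.
Proof.
rewrite -card_gt0; have [_ s_onto] := s_enum.
by rewrite (s_onto (s i)).1//; exists i.
Qed.

(** The bounds of the coupling argument with speed [1 / K], which both systems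
    satisfy. *)
Definition balanced_rate (phi : ('I_('C(N, d)) -> R) -> 'I_('C(N, d)) -> R) :=
  forall x i, (forall k, 0 <= x k) ->
    [/\ x i = 0 -> phi x i = 0,
        forall m, 0 < x i -> (forall k, x k <= m) -> 1 / K / m <= phi x i &
        forall m, 0 < m -> (forall k, m <= x k) -> phi x i <= 1 / K / m].

Lemma inv_load_bounds (x : 'I_('C(N, d)) -> R) i j (v : R) :
  (forall k, 0 <= x k) -> j \in s i -> v = server_load s x j ->
  [/\ forall m, 0 < x i -> (forall k, x k <= m) -> 1 / K / m <= v^-1 &
      forall m, 0 < m -> (forall k, m <= x k) -> v^-1 <= 1 / K / m].
Proof.
move=> x0 ji ->; split=> m m0 xm; rewrite div1r -invfM.
  rewrite lef_pV2 ?posrE ?server_load_le//.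
    by rewrite mulr_gt0// (lt_le_trans m0).
  rewrite (lt_le_trans m0)// /server_load (bigD1 i)//= lerDl.
  by apply: sumr_ge0.
have Km : 0 < K * m by rewrite mulr_gt0.
by rewrite lef_pV2 ?posrE ?server_load_ge// (lt_le_trans Km) ?server_load_ge.
Qed.

Lemma balanced_phi_lower : balanced_rate (phi_lower s).
Proof.
move=> x i x0; rewrite /phi_lower.
have [[j ji load_j] _] := minoverP (server_load s x) (s_neq0 i).
have [lb ub] := inv_load_bounds x0 ji load_j.
split=> [->|m xi|m m0 mx]; first by rewrite ltxx.
  by rewrite xi; exact: lb.
by rewrite (lt_le_trans m0)//; exact: ub.
Qed.

Lemma balanced_phi_upper : balanced_rate (phi_upper s).
Proof.
move=> x i x0; rewrite /phi_upper.
have [[j ji load_j] _] := maxoverP (server_load s x) (s_neq0 i).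
have [lb ub] := inv_load_bounds x0 ji load_j.
split=> [->|m xi|m m0 mx]; first by rewrite ltxx.
  by rewrite xi; exact: lb.
by rewrite (lt_le_trans m0)//; exact: ub.
Qed.

End Subsets.

(** * The single processor-sharing queue *)

Lemma measurable_phi_single (R : realType) :
  measurable_fun [set: R] (@phi_single R).
Proof.
apply: measurable_fun_if => //; first exact: measurable_fun_ltr.
rewrite (_ : _ `&` _ = `]0, +oo[%classic); last first.
  by rewrite setTI; apply/seteqP; split => x /=; rewrite in_itv/= andbT.
apply: subspace_continuous_measurable_fun => //.
apply: continuous_in_subspaceT => x; rewrite inE/= in_itv/= andbT => x0.
by apply: cvgV => //; rewrite gt_eqF.
Qed.

Lemma service_scale (R : realType) (c : R) (q : R -> R) (s t : R) :
  0 <= c -> 0 <= s -> {within `[0, +oo[, continuous q} ->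
  service (fun u => c * phi_single (q u)) s t
  = (c%:E * service (fun u => phi_single (q u)) s t)%E.
Proof.
move=> c0 s0 cq; rewrite /service -ge0_integralZl_EFin//.
- by move=> u _; rewrite lee_fin /phi_single; case: ifP => // q0; rewrite invr_ge0 ltW.
- apply/measurable_EFinP.
  apply: measurableT_comp; first exact: measurable_phi_single.
  apply: (@subspace_continuous_measurable_fun _ `[s, t]) => //.
  apply: continuous_subspaceW cq.
  by move=> u /=; rewrite !in_itv/= andbT => /andP[su _]; exact: le_trans su.
Qed.

Theorem mainTheorem3 (R : realType)
    (N d : nat) (d_ge1 : (1 <= d)%N) (d_leN : (d <= N)%N)
    (lambda : R) (lambda_gt0 : 0 < lambda)
    (s : 'I_('C(N, d)) -> {set 'I_N}) (s_enum : enum_subsets s)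
    (disp : measure_display) (T : measurableType disp) (P : probability T R)
    (X : 'I_d -> {RV P >-> R}) (X_ge0 : forall i w, 0 <= X i w)
    (Y : {RV P >-> R}) (Y_ge0 : forall w, 0 <= Y w)
    (Q : 'I_('C(N, d)) -> R -> R)
    (Q_fluid : fluid_solution lambda (ecdf_Xmin X) (ecdf Y) (phi_lower s) Q \/
               fluid_solution lambda (ecdf_Xmin X) (ecdf Y) (phi_upper s) Q)
    (q0 : R) (Q_init : forall i, Q i 0 = q0) :
  let PS_solution := PS_fluid_solution (lambda / 'C(N, d)%:R)
                       (1 / 'C(N.-1, d.-1)%:R) (ecdf_Xmin X) (ecdf Y) in
  (exists q : R -> R, PS_solution q /\ q 0 = q0) /\
  (forall q : R -> R, PS_solution q -> q 0 = q0 ->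
     forall i t, 0 <= t -> Q i t = q t).
Proof.
move=> PS_solution.
have [phi [phi_bal Q_phi]] : exists phi, balanced_rate phi /\
    fluid_solution lambda (ecdf_Xmin X) (ecdf Y) phi Q.
  case: Q_fluid => Q_phi; [exists (phi_lower s)|exists (phi_upper s)]; split=> //.
    exact: balanced_phi_lower.
  exact: balanced_phi_upper.
have Xmin_ge0 w : 0 <= Xmin X w.
  have d_neq0 : [set: 'I_d]%SET != finset.set0 by rewrite -card_gt0 cardsT card_ord.
  by have [[i _ Xi] _] := minoverP (X^~ w) d_neq0; rewrite /Xmin Xi X_ge0.
have M_gt0 : (0 < 'C(N, d))%N by rewrite bin_gt0.
pose i0 := Ordinal M_gt0.
pose a := lambda / 'C(N, d)%:R; pose c : R := 1 / 'C(N.-1, d.-1)%:R.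
have a_gt0 : 0 < a by rewrite divr_gt0// ltr0n.
have c_gt0 : 0 < c.
  by rewrite divr_gt0// ltr0n bin_gt0 -!subn1 leq_sub2r.
have Q_ge0 k t : 0 <= t -> 0 <= Q k t by case: (Q_phi k) => -[_ Q0 _]; exact: Q0.
have Q_eq i j t : 0 <= t -> Q i t = Q j t.
  apply: (@fluid_family_equal _ _ _ P (Xmin X : {RV P >-> R}) Y _ Q
    (fun i u => phi (fun k => Q k u) i) a c q0) => // [k|k u u0|k u m u0|k u m u0|k].
  - by case: (Q_phi k).
  - by case: (@phi_bal (fun k => Q k u) k) => // l; exact: Q_ge0.
  - by case: (@phi_bal (fun k => Q k u) k) => [l|]; [exact: Q_ge0|move=> _ + _; exact].
  - by case: (@phi_bal (fun k => Q k u) k) => [l|]; [exact: Q_ge0|move=> _ _; exact].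
  - by case: (Q_phi k).
have phi_diag t : 0 <= t -> phi (fun k => Q k t) i0 = c * phi_single (Q i0 t).
  move=> t0; have [phi0 lb ub] := @phi_bal (fun k => Q k t) i0 (fun k => Q_ge0 k t t0).
  rewrite /phi_single; case: ltP => [Qt|Qt].
    apply/le_anti; rewrite lb ?ub// => k; by rewrite (Q_eq k i0).
  by rewrite mulr0 phi0//; apply/le_anti; rewrite Qt Q_ge0.
split.
  exists (Q i0); split=> //; have [Qcont Qeq] := Q_phi i0; split=> // t t0.
  have eta_eq u : 0 <= u ->
      service (fun u => phi (fun k => Q k u) i0) u t
      = (c%:E * service (fun u => phi_single (Q i0 u)) u t)%E.
    move=> u0; rewrite -service_scale ?(ltW c_gt0)//; last by case: Qcont.
    apply: eq_integral => v; rewrite inE/= in_itv/= => /andP[uv _].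
    by rewrite phi_diag// (le_trans u0).
  rewrite (Qeq t t0) eta_eq//; congr (_ + _ * _)%E.
  apply: eq_integral => v; rewrite inE/= in_itv/= => /andP[v0 _].
  by rewrite eta_eq.
move=> q [q_cont q_eq] q_init i t t0.
have q_ge0 u : 0 <= u -> 0 <= q u by case: q_cont => _; exact.
(* The single queue joins the family, as the member of index None. *)
pose Q' o := if o is Some k then Q k else q.
pose r' o u := if o is Some k then phi (fun l => Q l u) k else c * phi_single (q u).
apply: (@fluid_family_equal _ _ _ P (Xmin X : {RV P >-> R}) Y _ Q' r' a c q0
  _ _ _ _ _ _ _ _ _ (Some i) None t) => //.
- by move=> [k|] //=; case: (Q_phi k).
- move=> [k|] u u0 /=; last by rewrite /phi_single => ->; rewrite ltxx mulr0.
  by case: (@phi_bal (fun k => Q k u) k) => // l; exact: Q_ge0.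
- move=> [k|] u m u0 /= Qu Qm.
    case: (@phi_bal (fun k => Q k u) k) => [l|_ lb _]; first exact: Q_ge0.
    by apply: lb => // l; exact: (Qm (Some l)).
  rewrite /phi_single Qu ler_pM2l// lef_pV2 ?posrE//; first exact: (Qm None).
  exact: lt_le_trans (Qm None).
- move=> [k|] u m u0 m0 /= Qm.
    case: (@phi_bal (fun k => Q k u) k) => [l|_ _ ub]; first exact: Q_ge0.
    by apply: ub => // l; exact: (Qm (Some l)).
  have qm := Qm None; have qu := lt_le_trans m0 qm.
  by rewrite /phi_single qu ler_pM2l// lef_pV2 ?posrE.
- by move=> [k|] //=; exact: Q_init.
- move=> [k|] /=; first by case: (Q_phi k).
  move=> u u0; rewrite (q_eq u u0) service_scale ?(ltW c_gt0)//; last by case: q_cont.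
  congr (_ + _ * _)%E.
  apply: eq_integral => v; rewrite inE/= in_itv/= => /andP[v0 _].
  by rewrite service_scale ?(ltW c_gt0)//; case: q_cont.
Qed.
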